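(* For every integer $n \geq 3$, $m(n) \leq \frac{(n+1)(n-2)}{2}$, where $m(n)$ is the maximum sort-number (with respect to the map $SC_{231}$) among all permutations in $S_n$.
   Context: Permutations $p \in S_n$ are written in one-line notation as words $p(1)p(2)\cdots p(n)$. A permutation contains a pattern $\sigma\in S_k$ if it has a (not necessarily contiguous) subsequence of $k$ entries in the same relative order as $\sigma$; otherwise it avoids $\sigma$. A sequence of distinct numbers contains $\sigma$ consecutively if some $k$ contiguous entries are in the same relative order as $\sigma$. $\mathrm{Av}_n(132,231)$ is the set of permutations in $S_n$ avoiding both $132$ and $231$ (equivalently, permutations having no index $1<i<n$ with $p(i-1)<p(i)>p(i+1)$). The map $SC_{231}: S_n \to S_n$ is defined by passing $p$ through a stack: the entries of $p$ are the input, read left to right; the stack and output start empty. While the input is nonempty, let $x$ be the next input entry. If, after pushing $x$ on top of the stack, the stack contents read from top to bottom would not contain $231$ consecutively, then push $x$; otherwise pop the top entry of the stack and append it to the right end of the output (and repeat with the same $x$). When the input is empty, pop all remaining stack entries from top to bottom, appending each to the output. The resulting output word is $SC_{231}(p)$. For example $SC_{231}(45231)=13254$ and $SC_{231}(132)=321$. The sort-number of $p \in S_n$ is the minimum integer $k \geq 0$ such that $SC_{231}^k(p) \in \mathrm{Av}_n(132,231)$, where $SC_{231}^k$ is the $k$-fold iterate (such a $k$ exists for every $p$). *)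

(* Defs.v *)
From mathcomp Require Import all_boot all_fingroup.

Set Implicit Arguments.
Unset Strict Implicit.
Unset Printing Implicit Defensive.

(* Words are lists of naturals; the one-line notation of p : 'S_n uses the
   letters 1..n, whereas 'I_n starts at 0. *)
Definition one_line (n : nat) (p : 'S_n) : seq nat :=
  [seq (p i).+1 | i <- enum 'I_n].

Definition same_order (s t : seq nat) : bool :=
  (size s == size t) &&
  all (fun i => all (fun j => (nth 0 s i < nth 0 s j) == (nth 0 t i < nth 0 t j))
                    (iota 0 (size s)))
      (iota 0 (size s)).

Definition contains (sigma s : seq nat) : Prop :=
  exists2 t, subseq t s & same_order t sigma.

Definition contains_consecutively (sigma s : seq nat) : bool :=
  has (fun i => same_order (take (size sigma) (drop i s)) sigma)
      (iota 0 (size s).+1).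

Definition avoids_132_231 (w : seq nat) : Prop :=
  ~ contains [:: 1; 3; 2] w /\ ~ contains [:: 2; 3; 1] w.

(* A stack is listed from top to bottom.  SC231_push handles one input entry x:
   it pops until x can be pushed, then returns the new stack and output.  On the
   empty stack x is always pushed, since [:: x] is shorter than the pattern. *)
Fixpoint SC231_push (x : nat) (stack output : seq nat) : seq nat * seq nat :=
  if stack is y :: stack' then
    if contains_consecutively [:: 2; 3; 1] (x :: stack)
    then SC231_push x stack' (rcons output y)
    else (x :: stack, output)
  else ([:: x], output).

Fixpoint SC231_run (input stack output : seq nat) : seq nat :=
  if input is x :: input' then
    let: (stack1, output1) := SC231_push x stack output in
    SC231_run input' stack1 output1
  else output ++ stack.

Definition SC231 (w : seq nat) : seq nat := SC231_run w [::] [::].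

Example SC231_45231 : SC231 [:: 4; 5; 2; 3; 1] = [:: 1; 3; 2; 5; 4].
Proof. by []. Qed.

Example SC231_132 : SC231 [:: 1; 3; 2] = [:: 3; 2; 1].
Proof. by []. Qed.

Definition is_sort_number (n : nat) (p : 'S_n) (k : nat) : Prop :=
  avoids_132_231 (iter k SC231 (one_line p)) /\
  forall j, avoids_132_231 (iter j SC231 (one_line p)) -> k <= j.

(* The second clause also asserts that every p has a sort-number, so that the
   maximum really ranges over all of 'S_n. *)
Definition is_max_sort_number (n m : nat) : Prop :=
  (exists p : 'S_n, is_sort_number p m) /\
  (forall p : 'S_n, exists2 k, is_sort_number p k & k <= m).

(* Main.v *)
(* Pushing a letter pops at most one letter, so SC231 w is the word of popped
   letters followed by the final stack.  Look at the two smallest letters a and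
   b of a word of length n.  Each pass exchanges them and never increases the
   number of letters between them: those letters are stacked on top of a or of
   b, which acts as a floor.  After the first pass they came off a stack, hence
   avoid 231 consecutively, and then a further pass pops at least one of them
   if there are two or more.  So a and b become adjacent within n - 1 passes,
   and adjacent they stay, playing the role of a single smallest letter.  Hence
   m(n) <= (n - 1) + m(n - 1). *)
Require Import Defs.
From mathcomp Require Import all_boot all_fingroup.
From mathcomp Require Import zify.

Set Implicit Arguments.
Unset Strict Implicit.
Unset Printing Implicit Defensive.

(** * A stack that pops at most one letter per push *)

(** On a stack that avoids 231 consecutively, only the new top window can violate: [x] plays 2, [y]
    plays 3 and [z] plays 1. *)
Definition forces_pop (x : nat) (s : seq nat) : bool :=
  if s is y :: z :: _ then (z < x) && (x < y) else false.

Definition push (s : seq nat) (x : nat) : seq nat :=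
  x :: (if forces_pop x s then behead s else s).

Definition stack_after : seq nat -> seq nat -> seq nat := foldl push.

Fixpoint popped (s w : seq nat) : seq nat :=
  if w is x :: w' then
    (if forces_pop x s then take 1 s else [::]) ++ popped (push s x) w'
  else [::].

Notation no231 s := (~~ contains_consecutively [:: 2; 3; 1] s).

Lemma contains231_cons x s :
  contains_consecutively [:: 2; 3; 1] (x :: s) =
  forces_pop x s || contains_consecutively [:: 2; 3; 1] s.
Proof.
rewrite {1}/contains_consecutively -[iota 0 _]/(0 :: iota (1 + 0) (size s).+1).
rewrite iotaDl -[0 :: _]cat1s has_cat has_seq1 has_map.
congr orb; case: s => [|y [|z s]] //=.
rewrite take0 /same_order /= !ltnn /= !andbT.
by case: (ltngtP x y); case: (ltngtP x z); case: (ltngtP y z) => //=; lia.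
Qed.

Lemma no231_push s x : no231 s -> no231 (push s x).
Proof.
rewrite /push contains231_cons negb_or; case: s => [|y [|z s]] // hs.
have hz : no231 (z :: s) by move: hs; rewrite contains231_cons negb_or => /andP[].
case: ifP => [/andP[zx xy]|-> //]; rewrite [behead _]/= hz andbT.
by case: s {hz hs} => //= t s; lia.
Qed.

Lemma no231_stack_after s w : no231 s -> no231 (stack_after s w).
Proof. by elim: w s => //= x w IH s hs; apply/IH/no231_push. Qed.

Lemma no231_suffix s t : no231 (s ++ t) -> no231 t.
Proof.
by elim: s => //= x s IH; rewrite contains231_cons negb_or => /andP[_ /IH].
Qed.

(* After one pop the new top [z] satisfies [z < x], so no second pop occurs. *)
Lemma SC231_pushE x s o : no231 s ->
  SC231_push x s o =
  (push s x, o ++ (if forces_pop x s then take 1 s else [::])).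
Proof.
case: s => [|y s] hs; first by rewrite /= cats0.
rewrite /SC231_push -/SC231_push contains231_cons (negbTE hs) orbF /push.
case: ifP => h; last by rewrite cats0.
case: s h hs => [//|z s] /= /andP[zx xy].
rewrite contains231_cons negb_or => /andP[_ hs].
rewrite contains231_cons (negbTE hs) orbF cats1.
by case: s hs => //= t s _; rewrite [x < z]ltnNge (ltnW zx) andbF.
Qed.

Lemma SC231_popped_stack w :
  SC231 w = popped [::] w ++ stack_after [::] w.
Proof.
have run s o : no231 s ->
    SC231_run w s o = o ++ popped s w ++ stack_after s w.
  elim: w s o => [|x w IH] s o hs //.
  rewrite -[SC231_run _ _ _]/(let: (s1, o1) := SC231_push x s o in
                              SC231_run w s1 o1).
  by rewrite SC231_pushE // IH ?no231_push //= -!catA.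
exact: run.
Qed.

Lemma popped_cat s u v :
  popped s (u ++ v) = popped s u ++ popped (stack_after s u) v.
Proof. by elim: u s => //= x u IH s; rewrite IH catA. Qed.

Lemma stack_after_cat s u v :
  stack_after s (u ++ v) = stack_after (stack_after s u) v.
Proof. exact: foldl_cat. Qed.

(** Conservation of letters, stated with counts so that permutation facts follow by arithmetic, even
    after cancelling a known part of the stack. *)
Lemma count_popped_stack p s w :
  count p (popped s w) + count p (stack_after s w) = count p s + count p w.
Proof.
elim: w s => [|x w IH] s /=; first by rewrite addn0.
rewrite count_cat -addnA IH /push /=.
by case: s => [|y [|z s]] /=; [lia | lia | case: ifP => _ /=; lia].
Qed.

Lemma perm_SC231 w : perm_eq (SC231 w) w.
Proof.
by apply/seq.permP=> p; rewrite SC231_popped_stack count_cat count_popped_stack.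
Qed.

(** * Small letters as floors of the stack *)

Lemma forces_pop_low x s : all (ltn x) s -> forces_pop x s = false.
Proof. by case: s => [|y [|z s]] //= /and3P[]; lia. Qed.

Lemma forces_pop_gt x y s : y < x -> forces_pop x (y :: s) = false.
Proof. by case: s => //= z s; lia. Qed.

Lemma mem_stack_after s w : {subset stack_after s w <= s ++ w}.
Proof.
have /perm_mem eqm : perm_eq (popped s w ++ stack_after s w) (s ++ w).
  by apply/seq.permP=> p; rewrite !count_cat count_popped_stack.
by move=> x xs; rewrite -eqm mem_cat xs orbT.
Qed.

Lemma all_stack_after p w : all p w -> all p (stack_after [::] w).
Proof. by move/allP=> h; apply/allP=> x /mem_stack_after /h. Qed.

(* [u] and [o] come before [c] and [s]: what happens above a stack letter smaller
   than the remaining input depends neither on it nor on what lies beneath. *)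
Lemma run_above_floor t w : exists u o, forall c s, all (ltn c) w ->
  stack_after (t ++ c :: s) w = u ++ c :: s /\ popped (t ++ c :: s) w = o.
Proof.
elim: w t => [|x w IH] t; first by exists t, [::].
(* The pop test with a floor beneath [t]: under a single letter [y] the floor plays 1, and directly
   on the floor nothing pops. *)
pose b := if t is y :: z :: _ then (z < x) && (x < y)
          else if t is [:: y] then x < y else false.
have [u [o H]] := IH (x :: (if b then behead t else t)).
exists u, ((if b then take 1 t else [::]) ++ o).
move=> c s /= /andP[cx /(H c s)[]].
have bE : forces_pop x (t ++ c :: s) = b.
  rewrite /b; case: t {b H} => [|y [|z t]] //=; last by rewrite cx.
  by case: s => //= z s; lia.
rewrite /push bE => <- <-.
by rewrite /b; case: t {b H bE} => [|y [|z t]] //=; case: ifP; rewrite ?take0.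
Qed.

(** Let [r] be the next letter. If [r < p], then [p], [q], [r] form a 231; if [p < r < q], then [q]
    is popped. So without a pop the letters keep rising, and the final [c] completes a 231. *)
Lemma popped_after_ascent p q c Y S s :
  p < q -> c < p -> all (ltn c) Y -> uniq [:: p, q & Y] ->
  no231 [:: p, q & Y ++ c :: S] -> popped [:: q, p & s] Y != [::].
Proof.
elim: Y p q s => [|r Y IH] p q s pq cp.
  by move=> _ _; rewrite /= contains231_cons /= cp pq.
move=> /= /andP[cr cY]; rewrite !inE => uq.
rewrite contains231_cons negb_or => /andP[h1 h2].
case: ifP => // h3; rewrite /push /= h3 /=.
have qr : q < r.
  move: uq h1 h3 => /= /and3P[]; rewrite !negb_or.
  move=> /and3P[_ pr _] /andP[qr _] _; lia.
apply: IH h2 => //; first exact: leq_trans cp (ltnW pq).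
by move: uq => /= /and4P[_ -> -> ->].
Qed.

(* If nothing were popped, [Y] would avoid both 231 and 132 consecutively and
   start with an ascent, so it would increase; but its last two letters,
   followed by [c], form no 231. *)
Lemma popped_no231 c Y S d s : all (ltn c) Y -> all (ltn d) Y -> uniq Y ->
  1 < size Y -> no231 (Y ++ c :: S) -> popped (d :: s) Y != [::].
Proof.
case: Y => [|p [|q Y]] // /and3P[cp cq cY] /and3P[dp dq dY] uY _ no.
rewrite -[popped _ _]/(_ ++ popped (push _ p) (q :: Y)) /push.
rewrite forces_pop_gt //= [d < q]dq; case: ifP => //= /negbT qp.
rewrite /push /= (negbTE qp) andbF; apply: popped_after_ascent no => //.
by move: uY qp; rewrite /= inE; case: ltngtP.
Qed.

(** * One pass on the two smallest letters *)

Definition low (a b : nat) (s : seq nat) : bool :=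
  all (fun x => (a < x) && (b < x)) s.

Lemma lowC a b s : low a b s = low b a s.
Proof. by apply: eq_all => x; rewrite andbC. Qed.

Lemma low_cat a b s t : low a b (s ++ t) = low a b s && low a b t.
Proof. exact: all_cat. Qed.

Lemma low_ltn a b s : low a b s -> all (ltn a) s && all (ltn b) s.
Proof. by rewrite -all_predI. Qed.

(** [a] pops nothing, [X] runs above the floor [a] and leaves [u], then [b] arrives and [R] runs
    above the floor [b]. Read from the top, the final stack shows [b] before [a]. *)
Lemma SC231_between (a b : nat) (L X R : seq nat) :
  a != b -> uniq (L ++ X ++ R) -> low a b (L ++ X ++ R) ->
  exists L' X' R' : seq nat,
  [/\ SC231 (L ++ a :: X ++ b :: R) = L' ++ b :: X' ++ a :: R',
      uniq (L' ++ X' ++ R'), low b a (L' ++ X' ++ R'), no231 (X' ++ a :: R')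
    & [/\ size X' <= size X, a < b -> size X' != 1
        & no231 (X ++ b :: R) -> 1 < size X -> size X' < size X]].
Proof.
move=> ab uw lw; move: (lw); rewrite !low_cat => /and3P[lL lX lR].
have /andP[aL bL] := low_ltn lL; have /andP[aX bX] := low_ltn lX.
have /andP[aR bR] := low_ltn lR.
pose s := stack_after [::] L.
have as_ : all (ltn a) s := all_stack_after aL.
have bs : all (ltn b) s := all_stack_after bL.
have [u [o /(_ a s aX)[/= Hu Ho]]] := run_above_floor [::] X.
have [v [o' Hv]] := run_above_floor [::] R.
have pou : perm_eq (o ++ u) X.
  apply/seq.permP=> p; have := count_popped_stack p (a :: s) X.
  by rewrite Hu Ho !count_cat addnA [RHS]addnC => /addIn.
have szu : size o + size u = size X by rewrite -size_cat (perm_size pou).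
have bu : all (ltn b) u.
  by move: bX; rewrite -(perm_all _ pou) all_cat => /andP[].
(* A pop caused by [b] needs a letter smaller than [b] in second place. Only [a] can be one, so
   [a < b] and [u] is a single letter. *)
pose X' := if (a < b) && (size u == 1) then [::] else u.
have pb : push (u ++ a :: s) b = b :: X' ++ a :: s.
  rewrite /push /X'; case: (u) bu => [|y [|z t]] /=.
  - by rewrite andbF; case: (s) bs => //= z t /andP[bz _]; rewrite ltnNge (ltnW bz).
  - by move=> /andP[-> _]; rewrite eqxx !andbT; case: ifP.
  by move=> /and3P[_ bz _]; rewrite andbF [z < b]ltnNge (ltnW bz).
have stE : stack_after [::] (L ++ a :: X ++ b :: R) = v ++ b :: X' ++ a :: s.
  rewrite !(stack_after_cat, stack_after_cat _ (_ :: _)) /= -/s.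
  have -> : push s a = a :: s by rewrite /push forces_pop_low.
  by rewrite Hu pb; have [] := Hv b (X' ++ a :: s) bR.
have SCE : SC231 (L ++ a :: X ++ b :: R) =
  (popped [::] (L ++ a :: X ++ b :: R) ++ v) ++ b :: X' ++ a :: s.
  by rewrite SC231_popped_stack stE catA.
set L' := _ ++ v in SCE.
have pe : perm_eq (L' ++ X' ++ s) (L ++ X ++ R).
  have := perm_SC231 (L ++ a :: X ++ b :: R); rewrite SCE.
  move=> /seq.permP pe; apply/seq.permP=> p; move: (pe p).
  by rewrite !(count_cat, count_cat _ (_ :: _)) /=; clear; lia.
exists L', X', s; split=> //.
- by rewrite (perm_uniq pe).
- by rewrite lowC /low (perm_all _ pe).
(* This is the hypothesis for shrinking in the next pass, with [a] and [b] exchanged. *)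
- by apply: (@no231_suffix (v ++ [:: b])); rewrite -catA -stE no231_stack_after.
split.
- by rewrite -szu /X'; case: ifP => // _; rewrite leq_addl.
- by move=> lab; rewrite /X' lab /=; case: ifP => //= ->.
move=> no X1; apply: (@leq_ltn_trans (size u)).
  by rewrite /X'; case: ifP.
have uX : uniq X by move: uw; rewrite !cat_uniq => /and3P[_ _ /and3P[]].
(* In the word, [X] is followed by [b]; on the stack, it runs above [a]. *)
have := popped_no231 s bX aX uX X1 no.
by rewrite Ho -szu -size_eq0; case: (size o) => // i _; rewrite ltnS leq_addl.
Qed.

(** * Passes until the two smallest letters are adjacent *)

Definition adjacent_within (k0 : nat) (w : seq nat) : Prop :=
  exists k (a b : nat) (L R : seq nat),
  [/\ k <= k0, iter k SC231 w = L ++ a :: b :: R, a != b,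
      uniq (L ++ R) & low a b (L ++ R)].

Lemma adjacent_within_le k k' w :
  k <= k' -> adjacent_within k w -> adjacent_within k' w.
Proof.
move=> kk' [i [a [b [L [R [ik *]]]]]].
by exists i, a, b, L, R; split=> //; apply: leq_trans kk'.
Qed.

Lemma adjacent_withinS k w :
  adjacent_within k (SC231 w) -> adjacent_within k.+1 w.
Proof.
move=> [i [a [b [L [R [ik H *]]]]]].
by exists i.+1, a, b, L, R; split=> //; rewrite iterSr.
Qed.

Lemma adjacent_within0 (a b : nat) L R :
  a != b -> uniq (L ++ R) -> low a b (L ++ R) ->
  adjacent_within 0 (L ++ a :: b :: R).
Proof. by exists 0, a, b, L, R. Qed.

Lemma adjacent_size_le1_ltn (a b : nat) (L X R : seq nat) :
  a < b -> uniq (L ++ X ++ R) -> low a b (L ++ X ++ R) -> size X <= 1 ->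
  adjacent_within 1 (L ++ a :: X ++ b :: R).
Proof.
move=> ab uw lw X1; have neq : a != b by rewrite neq_ltn ab.
have [L' [X' [R' [E uw' lw' _ [X'X /(_ ab) X'1 _]]]]] := SC231_between neq uw lw.
have X'0 : X' = [::].
  have : size X' <= 1 by apply: leq_trans X1.
  by case: (X') X'1 => [|? []].
rewrite X'0 in E uw' lw'; apply: adjacent_withinS; rewrite E.
by apply: (adjacent_within0 _ uw' lw'); rewrite eq_sym.
Qed.

(** If [b < a], one pass is spent on the exchange, which puts the smaller letter first. *)
Lemma adjacent_size_le1 (a b : nat) (L X R : seq nat) :
  a != b -> uniq (L ++ X ++ R) -> low a b (L ++ X ++ R) -> size X <= 1 ->
  adjacent_within 2 (L ++ a :: X ++ b :: R).
Proof.
move=> neq uw lw X1; have [ab|ba] := ltnP a b.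
  exact: (adjacent_within_le _ (adjacent_size_le1_ltn ab uw lw X1)).
have [L' [X' [R' [E uw' lw' _ [X'X _ _]]]]] := SC231_between neq uw lw.
apply: adjacent_withinS; rewrite E.
apply: (adjacent_size_le1_ltn _ uw' lw' (leq_trans X'X X1)).
by rewrite ltn_neqAle eq_sym neq.
Qed.

(** Each pass removes a letter while at least two lie between. From two letters, one pass leaves
    none if [a < b]; otherwise at most one is left with the smaller letter now first, and a second
    pass suffices. Hence the 2 in the maximum. *)
Lemma adjacent_no231 (a b : nat) (L X R : seq nat) :
  a != b -> uniq (L ++ X ++ R) -> low a b (L ++ X ++ R) ->
  no231 (X ++ b :: R) ->
  adjacent_within (maxn 2 (size X)) (L ++ a :: X ++ b :: R).
Proof.
have [n] := ubnP (size X).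
elim: n => // n IH in a b L X R * => Xn neq uw lw no.
have [X1|X2] := leqP (size X) 1.
  exact: (adjacent_within_le (leq_maxl _ _) (adjacent_size_le1 neq uw lw X1)).
have [L' [X' [R' [E uw' lw' no' [_ X'1 /(_ no X2) X'X]]]]] :=
  SC231_between neq uw lw.
have neq' : b != a by rewrite eq_sym.
have [X3|X3] := ltnP 2 (size X).
  apply: (@adjacent_within_le (maxn 2 (size X')).+1).
    by rewrite gtn_max X3.
  apply: adjacent_withinS; rewrite E.
  exact: (IH _ _ _ _ _ (leq_trans X'X Xn) neq' uw' lw' no').
apply: adjacent_withinS; rewrite E.
have X'2 : size X' <= 1 by rewrite -ltnS (leq_trans X'X).
have [ab|ba] := ltnP a b.
  have X'0 : X' = [::] by case: (X') X'2 (X'1 ab) => [|? []].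
  rewrite X'0 in uw' lw' *.
  exact: (adjacent_within_le (leq0n _) (adjacent_within0 neq' uw' lw')).
by apply: (adjacent_size_le1_ltn _ uw' lw' X'2); rewrite ltn_neqAle neq'.
Qed.

(** The extra pass makes the letters in between come off a stack, so that [adjacent_no231]
    applies. *)
Lemma adjacent_within_size (a b : nat) (L X R : seq nat) :
  a != b -> uniq (L ++ X ++ R) -> low a b (L ++ X ++ R) ->
  adjacent_within (size X).+1 (L ++ a :: X ++ b :: R).
Proof.
move=> neq uw lw; have [/size0nil X0|X0] := posnP (size X).
  rewrite X0 in uw lw *.
  exact: (adjacent_within_le (leq0n _) (adjacent_within0 neq uw lw)).
have [X1|X2] := leqP (size X) 1.
  by apply: (adjacent_within_le _ (adjacent_size_le1 neq uw lw X1)).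
have [L' [X' [R' [E uw' lw' no' [X'X _ _]]]]] := SC231_between neq uw lw.
have neq' : b != a by rewrite eq_sym.
apply: (@adjacent_within_le (maxn 2 (size X')).+1).
  by rewrite ltnS geq_max X2 X'X.
by apply: adjacent_withinS; rewrite E; exact: (adjacent_no231 neq' uw' lw' no').
Qed.

(** * An adjacent smallest pair acts as one letter *)

(** None of [a], [b], [c] pops anything on arrival, and [R] runs identically above the floors [b]
    and [c]. So the same [L'] and [R'] serve both words. *)
Lemma SC231_merge (a b c : nat) L R :
  low a b (L ++ R) -> all (ltn c) (L ++ R) ->
  exists L' R' : seq nat, [/\ SC231 (L ++ a :: b :: R) = L' ++ b :: a :: R',
    SC231 (L ++ c :: R) = L' ++ c :: R' & perm_eq (L' ++ R') (L ++ R)].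
Proof.
rewrite low_cat all_cat => /andP[/low_ltn/andP[aL bL] /low_ltn/andP[aR bR]].
move=> /andP[cL cR].
have [u [o H]] := run_above_floor [::] R.
pose s := stack_after [::] L.
have as_ : all (ltn a) s := all_stack_after aL.
have bs : all (ltn b) s := all_stack_after bL.
have cs : all (ltn c) s := all_stack_after cL.
have pa : forces_pop a s = false := forces_pop_low as_.
have pb : forces_pop b (a :: s) = false.
  by case: (s) bs => //= z t /andP[bz _]; rewrite [z < b]ltnNge (ltnW bz).
have pc : forces_pop c s = false := forces_pop_low cs.
have [/= Hb ob] := H b (a :: s) bR; have [/= Hc oc] := H c s cR.
have SCc : SC231 (L ++ c :: R) = (popped [::] L ++ o ++ u) ++ c :: s.
  rewrite SC231_popped_stack stack_after_cat popped_cat -/s /=.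
  by rewrite /push pc Hc oc -!catA.
exists (popped [::] L ++ o ++ u), s; split=> //.
  rewrite SC231_popped_stack stack_after_cat popped_cat -/s.
  rewrite -[popped s _]/(_ ++ _ ++ popped (push (push s a) b) R).
  rewrite -[stack_after s _]/(stack_after (push (push s a) b) R).
  by rewrite /push pa pb Hb ob -!catA.
have := perm_SC231 (L ++ c :: R); rewrite SCc.
move=> /seq.permP pe; apply/seq.permP=> p; move: (pe p).
by rewrite !count_cat /=; clear; lia.
Qed.

Lemma iter_SC231_merge k a b c L R :
  a != b -> low a b (L ++ R) -> all (ltn c) (L ++ R) ->
  exists (a' b' : nat) (L' R' : seq nat),
  [/\ iter k SC231 (L ++ a :: b :: R) = L' ++ a' :: b' :: R',
      iter k SC231 (L ++ c :: R) = L' ++ c :: R',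
      a' != b', low a' b' (L' ++ R') & all (ltn c) (L' ++ R')].
Proof.
elim: k a b L R => [|k IH] a b L R ab lw cw; first by exists a, b, L, R.
have [L' [R' [E1 E2 pe]]] := SC231_merge lw cw.
have := IH b a L' R'; rewrite eq_sym lowC /low !(perm_all _ pe).
by rewrite !iterSr E1 E2; apply.
Qed.

(** * Words without a peak *)

Definition valley (w : seq nat) : Prop :=
  exists L R, [/\ w = L ++ R, pairwise gtn L & pairwise ltn R].

(** The smallest letter [c] sits at the turning point. The pair takes its place, on the increasing
    side if [a < b] and on the decreasing side otherwise. *)
Lemma valley_merged a b c L R :
  a != b -> low a b (L ++ R) -> all (ltn c) (L ++ R) ->
  valley (L ++ c :: R) -> valley (L ++ a :: b :: R).
Proof.
move=> ab lw; rewrite all_cat => /andP[cL cR] [A [B [E dA iB]]].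
suff [dL iR] : pairwise gtn L /\ pairwise ltn R.
  move: lw; rewrite low_cat => /andP[/low_ltn/andP[aL bL] /low_ltn/andP[aR bR]].
  have [lt_ab|lt_ba|eq_ab] := ltngtP a b; last by rewrite eq_ab eqxx in ab.
    exists L, [:: a, b & R]; split=> //=.
    by rewrite [a < b]lt_ab aR bR iR.
  exists (L ++ [:: a; b]), R; split=> //; first by rewrite -catA.
  rewrite pairwise_cat dL /= [b < a]lt_ba !andbT; apply/allrelP => x y /= xL.
  by rewrite !inE => /orP[]/eqP->; [apply: (allP aL) | apply: (allP bL)].
(* Locate the cut between [A] and [B]. Inside [L], it would put a letter of [L] before [c] in the
   increasing part; past the first letter of [R], it would put that letter after [c] in the
   decreasing part. *)
have EA : A = take (size A) (L ++ c :: R) by rewrite E take_size_cat.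
have EB : B = drop (size A) (L ++ c :: R) by rewrite E drop_size_cat.
move: EA EB dA iB; rewrite take_cat drop_cat.
move: (size A) => n; case: ltnP => [nL -> ->|_ -> ->].
  rewrite pairwise_cat => _ /andP[/allrelP/= bad _].
  case D: (drop n L) bad => [|x D'].
    move/(congr1 size): D => /=; rewrite size_drop => /eqP.
    by rewrite subn_eq0 leqNgt nL.
  move=> /(_ x c); rewrite !inE !eqxx => /(_ isT isT) xc.
  have /(allP cL) /= : x \in L.
    by apply: (@mem_drop n); rewrite D inE eqxx.
  by rewrite ltnNge (ltnW xc).
case: (_ - _) => [|j] /=; first by rewrite cats0 => -> /andP[].
rewrite pairwise_cat /= => /and4P[_ -> tc _] iD; split=> //.
rewrite -(cat_take_drop j R); case D: (take j R) tc => [//|x T] /= /andP[xc _].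
have /(allP cR) /= : x \in R by apply: (@mem_take j); rewrite D inE eqxx.
by rewrite ltnNge (ltnW xc).
Qed.

Lemma subseq_catP (s u v : seq nat) : subseq s (u ++ v) ->
  exists s1 s2, [/\ s = s1 ++ s2, subseq s1 u & subseq s2 v].
Proof.
move=> /subseqP[m sm ->]; rewrite -(cat_take_drop (size u) m) mask_cat.
  exists (mask (take (size u) m) u), (mask (drop (size u) m) v).
  by split=> //; apply: mask_subseq.
by rewrite size_takel // sm size_cat leq_addr.
Qed.

(** Either [y] and [z] both lie in the increasing part, or [x] and [y] both lie in the decreasing
    part. *)
Lemma valley_no_peak x y z w :
  valley w -> subseq [:: x; y; z] w -> x < y -> z < y -> False.
Proof.
move=> [L [R [-> dL iR]]] /subseq_catP[s1 [s2 [E]]].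
move=> /subseq_pairwise/(_ dL) d1 /subseq_pairwise/(_ iR) i2 xy zy.
have yx : y < x = false by rewrite ltnNge (ltnW xy).
have yz : y < z = false by rewrite ltnNge (ltnW zy).
case: s1 => [|x1 [|y1 s1]] /= in E d1.
- by move: i2; rewrite -E /= yz !andbF.
- by case: E i2 => _ <- /=; rewrite yz.
by case: E d1 => <- <- _; rewrite yx.
Qed.

(** These two comparisons make the middle letter a peak, for 132 and 231 alike. *)
Lemma same_order3P x y z t : same_order t [:: x; y; z] ->
  exists a b c, [/\ t = [:: a; b; c], (a < b) = (x < y) & (c < b) = (z < y)].
Proof.
case: t => [|a [|b [|c [|d t]]]] //.
rewrite /same_order /= !andbT => /and3P[] /and3P[_ /eqP ab _] _ /and3P[_ /eqP cb _].
by exists a, b, c.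
Qed.

Lemma valley_avoids w : valley w -> avoids_132_231 w.
Proof.
move=> vw; split=> -[t tw /same_order3P[a [b [c [E ab cb]]]]];
  by apply: (valley_no_peak vw (x := a) (y := b) (z := c)); rewrite -?E ?ab ?cb.
Qed.

(** * Induction on the length of the word *)

Lemma min_split (w : seq nat) : uniq w -> 0 < size w ->
  exists m L R, w = L ++ m :: R /\ all (ltn m) (L ++ R).
Proof.
case: w => [//|x w] uw _.
have ex : exists m, m \in x :: w by exists x; rewrite inE eqxx.
case: (ex_minnP ex) => m mw minm; case/path.splitPr: mw uw minm => L R.
rewrite -cat1s uniq_catCA => /= /andP[mLR _] minm.
exists m, L, R; split=> //; apply/allP => y yLR /=.
rewrite ltn_neqAle eq_sym (memPn mLR _ yLR); apply: minm.
by move: yLR; rewrite !mem_cat inE => /orP[->|->]; rewrite ?orbT.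
Qed.

Lemma two_min_split (w : seq nat) : uniq w -> 1 < size w ->
  exists (a b : nat) (L X R : seq nat), [/\ w = L ++ a :: X ++ b :: R,
    a != b, uniq (L ++ X ++ R) & low a b (L ++ X ++ R)].
Proof.
move=> uw w1; have [m [L [R [E mLR]]]] := min_split uw (ltnW w1).
have uLR : uniq (L ++ R).
  by move: uw; rewrite E -cat1s uniq_catCA => /andP[].
have sLR : 0 < size (L ++ R).
  by move: w1; rewrite E !size_cat /= addnS.
have [m' [L' [R' [E' mLR']]]] := min_split uLR sLR.
have lw s : perm_eq (m' :: s) (L ++ R) -> uniq s && low m m' s && (m < m').
  move=> pe; have : uniq (m' :: s) by rewrite (perm_uniq pe).
  move: mLR; rewrite -(perm_all _ pe) /= => /andP[-> ms] /andP[_ ->].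
  rewrite andbT; apply/allP => y ys; rewrite [m < y](allP ms) //=.
  have : perm_eq (m' :: s) (m' :: L' ++ R').
    by rewrite (perm_trans pe) // E' -[m' :: R']cat1s perm_catCA.
  by rewrite perm_cons => /perm_mem sE; apply: (allP mLR'); rewrite -sE.
have : m' \in L ++ R by rewrite E' mem_cat inE eqxx orbT.
(* The side of [m] on which [m'] lies decides which of the two is called [a]. *)
rewrite mem_cat => /orP[] /path.splitPr m'LR; case: m'LR E {E' mLR uLR sLR} lw.
  move=> L1 L2 E lw; exists m', m, L1, L2, R.
  have /lw/andP[/andP[us ls] mm'] : perm_eq (m' :: L1 ++ L2 ++ R) ((L1 ++ m' :: L2) ++ R).
    by rewrite -cat1s -catA /= -cat1s perm_catCA.
  by rewrite E -catA lowC neq_ltn mm' orbT.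
move=> R1 R2 E lw; exists m, m', L, R1, R2.
have /lw/andP[/andP[us ls] mm'] : perm_eq (m' :: L ++ R1 ++ R2) (L ++ R1 ++ m' :: R2).
  by rewrite perm_sym -[m' :: R2]cat1s catA perm_catCA /= -catA.
by rewrite E neq_ltn mm'.
Qed.

(** A word of [n.+3] letters needs at most [n.+2] passes before merging, and
    [n (n + 3) + 2 (n + 2) = (n + 1) (n + 4)]. Doubling [k] avoids division. *)
Lemma iter_SC231_valley n w : uniq w -> size w = n.+2 ->
  exists2 k, k.*2 <= n * (n + 3) & valley (iter k SC231 w).
Proof.
elim: n w => [|n IH] w uw sw.
  exists 0 => //; case: w sw uw => [|a [|b [|c w]]] //= _ _.
  by exists [:: a], [:: b].
have w1 : 1 < size w by rewrite sw.
have [a [b [L [X [R [E ab uLR lLR]]]]]] := two_min_split uw w1.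
have sX : (size X).+1 <= n.+2.
  by move: sw; rewrite E size_cat /= size_cat /=; clear; lia.
have := adjacent_within_le sX (adjacent_within_size ab uLR lLR).
rewrite -E => -[k1 [a' [b' [L' [R' [kn E' ab' uLR' lLR']]]]]].
have szi : size (iter k1 SC231 w) = n.+3.
  by rewrite -sw; elim: (k1) => //= k <-; rewrite (perm_size (perm_SC231 _)).
have aLR' : all (ltn a') (L' ++ R') by have /andP[] := low_ltn lLR'.
(* The pair is merged into [a'] itself, still below all other letters. The letters need not form an
   interval, which is why the induction is over duplicate-free words. *)
have [||k2 k2n vk2] := IH (L' ++ a' :: R').
- rewrite -cat1s uniq_catCA /= uLR' andbT; apply/negP => /(allP aLR') /=.
  by rewrite ltnn.
- by move: szi; rewrite E' !size_cat /= !addnS => -[->].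
exists (k2 + k1); first by move: kn k2n; clear; nia.
have [a'' [b'' [L'' [R'' [E1 E2 ab'' lLR'' cLR'']]]]] :=
  iter_SC231_merge k2 ab' lLR' aLR'.
rewrite iterD E' E1; apply: (valley_merged ab'' lLR'' cLR'').
by rewrite -E2.
Qed.

(** * Sort-numbers and their maximum *)

(** Decidable containment lets [ex_minnP] extract the least number of passes. *)
Definition containsb (sigma w : seq nat) : bool :=
  [exists m : (size w).-tuple bool, same_order (mask m w) sigma].

Lemma containsP sigma w : reflect (contains sigma w) (containsb sigma w).
Proof.
apply: (iffP existsP) => [[m so]|[t /subseqP[m sm ->] so]].
  by exists (mask m w) => //; apply: mask_subseq.
by exists (Tuple (introT eqP sm)).
Qed.

Lemma avoids_132_231P w :
  reflect (avoids_132_231 w)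
    (~~ containsb [:: 1; 3; 2] w && ~~ containsb [:: 2; 3; 1] w).
Proof.
apply: (iffP andP) => -[h1 h2]; split.
- by move/containsP; apply/negP.
- by move/containsP; apply/negP.
- by apply/negP => /containsP.
by apply/negP => /containsP.
Qed.

Lemma is_sort_number_le n (p : 'S_n) k :
  avoids_132_231 (iter k SC231 (one_line p)) ->
  exists2 m, is_sort_number p m & m <= k.
Proof.
move=> /avoids_132_231P Ak.
have [m /avoids_132_231P Am minm] := ex_minnP (ex_intro (fun j => is_true _) k Ak).
by exists m; [split=> // j /avoids_132_231P /minm | apply: minm].
Qed.

Theorem theorem4p3 (n : nat) (hn : 3 <= n) :
  exists2 m, is_max_sort_number n m & m <= ((n + 1) * (n - 2)) %/ 2.
Proof.
have H (p : 'S_n) :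
    exists2 k, is_sort_number p k & k <= ((n + 1) * (n - 2)) %/ 2.
  have up : uniq (one_line p).
    by rewrite map_inj_uniq ?enum_uniq // => i j [/val_inj/perm_inj].
  have sp : size (one_line p) = (n - 2).+2.
    by rewrite size_map size_enum_ord; lia.
  have [k kn /valley_avoids/is_sort_number_le[m pm mk]] := iter_SC231_valley up sp.
  exists m => //; apply: leq_trans mk _; rewrite leq_divRL // muln2.
  by apply: leq_trans kn _; rewrite mulnC leq_mul2r; lia.
(* Choose all sort-numbers at once; their maximum is attained because the finite set of permutations
   contains the identity. *)
have [f fP fn] := fin_all_exists2 H.
have [|p0 fp0] := eq_bigmax f; first by apply/card_gt0P; exists 1%g.
exists (\max_p f p); last by rewrite fp0.
split=> [|p]; first by exists p0; rewrite fp0.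
by exists (f p); [apply: fP | apply: leq_bigmax].
Qed.
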